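(* There exist absolute constants $C,c>0$ such that the following holds. Let $A$ be a nonzero real $m\times n$ matrix with numerical rank $r=\|A\|_F^2/\|A\|_2^2$. Let $\varepsilon,\delta\in(0,1)$ and let $d\le m$ be an integer with $$d\ \ge\ C\,\frac{r}{\varepsilon^4\delta}\,\log\Bigl(\frac{r}{\varepsilon^4\delta}\Bigr).$$ Form a random $d\times n$ matrix $\tilde A$ as follows: independently for $s=1,\dots,d$, pick a row index $j_s\in\{1,\dots,m\}$ with $\mathbb P(j_s=j)=\|A_j\|_2^2/\|A\|_F^2$ (where $A_j$ is the $j$-th row of $A$), and let the $s$-th row of $\tilde A$ be $A_{j_s}/\|A_{j_s}\|_2$. Then with probability at least $1-2\exp(-c/\delta)$ the following holds simultaneously for every positive integer $k$: $$\|A-AP_k\|_2\ \le\ \sigma_{k+1}(A)+\varepsilon\|A\|_2,$$ where $P_k$ is the $n\times n$ orthogonal projection defined below.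
   Context: $\|\cdot\|_2$ denotes the spectral norm (operator norm $\ell_2\to\ell_2$) of a matrix and the Euclidean norm of a vector; $\|A\|_F$ is the Frobenius norm; $\sigma_1(A)\ge\sigma_2(A)\ge\dots\ge0$ are the singular values of $A$ (with $\sigma_j(A)=0$ for $j$ exceeding $\min(m,n)$). $P_k$ is the orthogonal projection in $\mathbb R^n$ onto the span of the singular vectors of $\tilde A$ lying in $\mathbb R^n$ (i.e. eigenvectors of $\tilde A^T\tilde A$) that correspond to the $k$ largest singular values of $\tilde A$, using only singular vectors with nonzero singular value (so if $k\ge \mathrm{rank}\,\tilde A$, $P_k$ is the projection onto the row space of $\tilde A$). Multiplying all rows of $\tilde A$ by a common positive scalar does not change $P_k$. *)

(* Defs.v *)
From HB Require Import structures.
From mathcomp Require Import all_boot all_order all_algebra.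
From mathcomp Require Import all_classical all_reals all_analysis.
From mathcomp Require Import Rstruct Rstruct_topology.

Set Implicit Arguments.
Unset Strict Implicit.
Unset Printing Implicit Defensive.

Import Order.TTheory GRing.Theory Num.Theory.
Local Open Scope ring_scope.
Local Open Scope classical_set_scope.

Notation R := Rdefinitions.R.

Definition vnorm n (x : 'cV[R]_n) : R := Num.sqrt (\sum_(i < n) x i 0 ^+ 2).

Definition rownorm m n (M : 'M[R]_(m, n)) (j : 'I_m) : R :=
  Num.sqrt (\sum_(i < n) M j i ^+ 2).

Definition frob m n (M : 'M[R]_(m, n)) : R :=
  Num.sqrt (\sum_(j < m) \sum_(i < n) M j i ^+ 2).

Definition opnorm m n (M : 'M[R]_(m, n)) : R :=
  sup [set vnorm (M *m x) | x in [set x : 'cV[R]_n | vnorm x <= 1]].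

Definition eig_decomp n (S V : 'M[R]_n) (lam : 'I_n -> R) : Prop :=
  [/\ V^T *m V = 1%:M,
      S = V *m diag_mx (\row_i lam i) *m V^T
    & forall i j : 'I_n, (i <= j)%N -> lam j <= lam i].

(* Singular values of A (1-indexed): sigma_j(A) = sqrt(j-th largest eigenvalue
   of A^T A) for 1 <= j <= n, and 0 for j > n (or j = 0 by convention),
   given an eigendecomposition (VA, lamA) of A^T A. *)
Definition sing_val n (lamA : 'I_n -> R) (j : nat) : R :=
  nth 0 [seq Num.sqrt (lamA i) | i <- enum 'I_n] j.-1.

(* P_k: orthogonal projection onto the span of the eigenvectors (columns of V)
   of Atilde^T Atilde belonging to the k largest eigenvalues, keeping only
   those with nonzero (i.e. positive) eigenvalue. *)
Definition proj_k n (V : 'M[R]_n) (lam : 'I_n -> R) (k : nat) : 'M[R]_n :=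
  \sum_(i < n | (i < k)%N && (0 < lam i)) (col i V *m (col i V)^T).

Definition sampled m n d (A : 'M[R]_(m, n)) (J : {ffun 'I_d -> 'I_m})
  : 'M[R]_(d, n) :=
  \matrix_(s < d, i < n) (A (J s) i / rownorm A (J s)).

Definition row_prob m n (A : 'M[R]_(m, n)) (j : 'I_m) : R :=
  rownorm A j ^+ 2 / frob A ^+ 2.

Definition sample_prob m n d (A : 'M[R]_(m, n))
  (E : {ffun 'I_d -> 'I_m} -> Prop) : R :=
  \sum_(J : {ffun 'I_d -> 'I_m} | `[< E J >]) \prod_(s < d) row_prob A (J s).

(* Main.v *)
Require Import Defs.
From HB Require Import structures.
From mathcomp Require Import all_boot all_order all_algebra.
From mathcomp Require Import complex lra ring.
From mathcomp Require Import all_classical all_reals all_analysis.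
From mathcomp Require Import Rstruct Rstruct_topology.

(* Let G_j be the orthogonal projection onto the line of the j-th row of A, so
   that Atilde^T Atilde = sum_s G_(j_s) has mean d Sigma with
   Sigma = A^T A / |A|_F^2, and let X = Atilde^T Atilde - d Sigma.

   Probability: resampling one index j_s gives an exchangeable copy X' of X
   with X - X' = G_(j_s) - G_j, and in the joint spectral weights of X and X'
   the scalar inequality
     2 (x - y) (x^(2p+1) - y^(2p+1)) <= (2p+1) (x - y)^2 (x^(2p) + y^(2p))
   becomes a trace inequality.  It yields
     E tr X^(2p+2) <= (2p+1) E tr (X + 2 d Sigma) X^(2p),
   a recursion in p that involves only K = d |Sigma| = d / r, and whose initial
   value E tr X^2 <= 2 d does not see the dimension n.  Markov's inequality at
   p of order eps^4 K bounds the probability that |X| exceeds eps^2 K / 2.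

   Linear algebra: if |X| <= t then for y = (1 - P_k) x the vector A y is
   controlled through Atilde^T Atilde, whose (k+1)-st eigenvalue is compared to
   that of d Sigma by Weyl's inequality; the square root of the error 2 t is
   what turns eps^2 into eps. *)

Set Implicit Arguments.
Unset Strict Implicit.
Unset Printing Implicit Defensive.

Import Order.TTheory GRing.Theory Num.Theory.
Local Open Scope ring_scope.

(** * Spectral weights and trace inequalities *)

(** The spectral theorem is applied over [F[i]], where a real symmetric matrix is Hermitian. The
    eigenvalues descend to [F]; [U] may stay complex, since only squared moduli built from it matter
    afterwards. *)
Lemma symmetric_unitary_diag (F : rcfType) (n : nat) (X : 'M[F]_n) :
  X^T = X ->
  exists (U : 'M[F[i]]_n) (lam : 'I_n -> F),
    [/\ U *m map_mx Num.conj U^T = 1%:M,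
        map_mx Num.conj U^T *m U = 1%:M &
        map_mx (real_complex F) X
          = map_mx Num.conj U^T *m diag_mx (\row_i (lam i)%:C%C) *m U].
Proof.
move=> symX; pose XC : 'M[F[i]]_n := map_mx (real_complex F) X.
have XCh : XC \is hermsymmx.
  apply: realsym_hermsym.
    apply/is_hermitianmxP; rewrite expr0 scale1r.
    by rewrite map_mx_id // /XC map_trmx symX.
  by apply/mxOverP => i j; rewrite mxE; apply/complex_realP; exists (X i j).
have UU := spectral_unitarymx XC.
exists (spectralmx XC), (fun i => complex.Re (spectral_diag XC 0 i)).
have U1 : spectralmx XC *m map_mx Num.conj (spectralmx XC)^T = 1%:M.
  exact/unitarymxP.
split=> //; first by rewrite mulmx1C.
have -> : \row_i (complex.Re (spectral_diag XC 0 i))%:C%C = spectral_diag XC.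
  apply/rowP => i; rewrite mxE RRe_real //.
  by have /mxOverP := hermitian_spectral_diag_real XCh; apply.
rewrite -(invmx_unitary UU).
exact/orthomx_spectralP/hermitian_normalmx.
Qed.

Lemma unitary_diag_exp (C : numClosedFieldType) (n : nat) (U V : 'M[C]_n)
    (D : 'rV[C]_n) (a : nat) : U *m V = 1%:M -> V *m U = 1%:M ->
  (V *m diag_mx D *m U) ^+ a = V *m diag_mx (\row_i (D 0 i ^+ a)) *m U.
Proof.
move=> UV VU; elim: a => [|a IH].
  rewrite expr0 (_ : diag_mx _ = 1%:M) ?mulmx1 ?VU //.
  by rewrite -diag_const_mx; congr diag_mx; apply/rowP => i; rewrite !mxE.
rewrite exprS IH -mulmxE !mulmxA -(mulmxA _ U V) UV mulmx1.
rewrite -(mulmxA V) mulmx_diag; congr (_ *m diag_mx _ *m _).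
by apply/rowP => i; rewrite !mxE exprS.
Qed.

(* The weights are the squared moduli of the inner products between the
   eigenvectors of [X] and those of [Y]. *)
Lemma trace_exp_mul_spectral (F : rcfType) (n : nat) (X Y : 'M[F]_n) :
  X^T = X -> Y^T = Y ->
  exists (lam mu : 'I_n -> F) (w : 'I_n -> 'I_n -> F),
    [/\ forall i j, 0 <= w i j,
        forall i, \sum_j w i j = 1 &
        forall a b : nat, \tr (X ^+ a *m Y ^+ b)
          = \sum_i \sum_j w i j * (lam i ^+ a * mu j ^+ b)].
Proof.
move=> /symmetric_unitary_diag[U [lam [UU UU' XE]]].
move=> /symmetric_unitary_diag[V [mu [VV VV' YE]]].
have [W WE] : exists W, W = U *m map_mx Num.conj V^T by eexists.
have WW' : map_mx Num.conj W^T = V *m map_mx Num.conj U^T.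
  rewrite WE trmx_mul map_mxM; congr (_ *m _); apply/matrixP => i j.
  by rewrite !mxE; exact: conjCK.
pose w i j := complex.Re (W i j * Num.conj (W i j)).
have wE i j : (w i j)%:C%C = W i j * Num.conj (W i j).
  by rewrite RRe_real // ger0_real // mul_conjC_ge0.
exists lam, mu, w; split.
- by move=> i j; rewrite -ler0c wE mul_conjC_ge0.
- move=> i; apply: (@complexI F); rewrite rmorph_sum rmorph1 /=.
  have <- : (W *m map_mx Num.conj W^T) i i = 1.
    by rewrite WW' WE mulmxA -(mulmxA U) VV' mulmx1 UU mxE eqxx.
  rewrite mxE; apply: eq_bigr => j _.
  by rewrite wE !mxE.
move=> a b; apply: (@complexI F).
rewrite -[LHS](@trace_map_mx _ _ (real_complex F)) map_mxM !rmorphXn /=.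
(* By cyclicity the trace becomes that of [diag(lam^a) W diag(mu^b) W'], with [W'] the conjugate
   transpose of [W]. *)
rewrite XE YE !unitary_diag_exp // -!mulmxA mxtrace_mulC !mulmxA.
rewrite -(mulmxA _ U) -WE -!mulmxA -WW' !mulmxA.
rewrite /mxtrace rmorph_sum /=; apply: eq_bigr => i _.
rewrite mul_diag_mx mxE rmorph_sum; apply: eq_bigr => j _.
rewrite mul_mx_diag !mxE.
transitivity ((w i j)%:C%C * ((lam i)%:C%C ^+ a * (mu j)%:C%C ^+ b)).
  rewrite wE; ring.
by rewrite !rmorphM !rmorphXn.
Qed.

(** The total exponent is even, so [x] and [y] may be replaced by their absolute values; then the
    two factors [|x|^(2p-i) - |y|^(2p-i)] and [|x|^i - |y|^i] never have opposite signs. *)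
Lemma exp_mul_rearrange (F : realDomainType) (x y : F) (p i : nat) :
  (i <= p.*2)%N ->
  x ^+ (p.*2 - i) * y ^+ i + y ^+ (p.*2 - i) * x ^+ i
    <= x ^+ p.*2 + y ^+ p.*2.
Proof.
move=> ip.
have nE (z : F) : z ^+ p.*2 = `|z| ^+ (p.*2 - i) * `|z| ^+ i.
  by rewrite -exprD subnK // -mul2n !exprM real_normK ?num_real.
have nL (z t : F) : z ^+ (p.*2 - i) * t ^+ i <= `|z| ^+ (p.*2 - i) * `|t| ^+ i.
  by rewrite -!normrX -normrM ler_norm.
apply: le_trans (lerD (nL x y) (nL y x)) _; rewrite !nE.
have : 0 <= (`|x| ^+ (p.*2 - i) - `|y| ^+ (p.*2 - i)) * (`|x| ^+ i - `|y| ^+ i).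
  have [xy|/ltW yx] := leP `|x| `|y|.
    by apply: mulr_le0; rewrite subr_le0 lerXn2r ?nnegrE.
  by apply: mulr_ge0; rewrite subr_ge0 lerXn2r ?nnegrE.
lra.
Qed.

(** Factor [x - y] out of the difference of powers and add the remaining sum to its own reversal:
    each of the [2p+1] symmetrised terms is bounded by [exp_mul_rearrange]. *)
Lemma mean_value_exp_odd (F : realDomainType) (x y : F) (p : nat) :
  2 * ((x - y) * (x ^+ p.*2.+1 - y ^+ p.*2.+1))
    <= p.*2.+1%:R * ((x - y) ^+ 2 * (x ^+ p.*2 + y ^+ p.*2)).
Proof.
rewrite subrXX [_ * (_ * \sum_(_ < _) _)]mulrA -expr2 mulrCA [leRHS]mulrCA.
apply: ler_wpM2l; first exact: sqr_ge0.
have -> : 2 * \sum_(i < p.*2.+1) x ^+ (p.*2.+1.-1 - i) * y ^+ i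
    = \sum_(i < p.*2.+1) (x ^+ (p.*2 - i) * y ^+ i + y ^+ (p.*2 - i) * x ^+ i).
  rewrite mulr_natl mulr2n big_split; congr (_ + _).
  rewrite (reindex_inj rev_ord_inj); apply: eq_bigr => i _ /=.
  by rewrite subSS subKn 1?mulrC // -ltnS.
rewrite -[X in X%:R]card_ord mulr_natl -sumr_const.
by apply: ler_sum => i _; apply: exp_mul_rearrange; rewrite -ltnS.
Qed.

Lemma mxtrace_sqr_ge0 (F : realDomainType) (m n : nat) (M : 'M[F]_(m, n)) :
  0 <= \tr (M^T *m M).
Proof.
apply: sumr_ge0 => i _; rewrite mxE; apply: sumr_ge0 => j _.
by rewrite mxE -expr2 sqr_ge0.
Qed.

Lemma trmx_mul_self_eq0 (F : realDomainType) (n : nat) (x : 'cV[F]_n) :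
  (x^T *m x) 0 0 = 0 -> x = 0.
Proof.
rewrite mxE => /eqP; rewrite psumr_eq0; last first.
  by move=> i _; rewrite mxE -expr2 sqr_ge0.
move=> /allP h; apply/colP => i; have := h i (mem_index_enum _).
by rewrite !mxE mulf_eq0 orbb => /eqP.
Qed.

Lemma trmx_exp (F : comNzRingType) (n : nat) (X : 'M[F]_n) (a : nat) :
  (X ^+ a)^T = X^T ^+ a.
Proof.
elim: a => [|a IH]; first by rewrite !expr0 trmx1.
by rewrite exprS exprSr -!mulmxE trmx_mul IH.
Qed.

Lemma mxtraceB (F : pzRingType) (n : nat) (X Y : 'M[F]_n) :
  \tr (X - Y) = \tr X - \tr Y.
Proof. by rewrite linearB. Qed.

Lemma mulmx_expD (F : pzSemiRingType) (n : nat) (X : 'M[F]_n) (a b : nat) :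
  X ^+ a *m X ^+ b = X ^+ (a + b).
Proof. by rewrite exprD. Qed.

Lemma mulmx_expS (F : pzSemiRingType) (n : nat) (X : 'M[F]_n) (a : nat) :
  X *m X ^+ a = X ^+ a.+1.
Proof. by rewrite exprS. Qed.

(** Both traces expand over pairs of eigenvalues with the same nonnegative weights, so the scalar
    inequality can be summed term by term even though [X] and [Y] need not commute. *)
Lemma mxtrace_mean_value (F : rcfType) (n : nat) (X Y : 'M[F]_n) (p : nat) :
  X^T = X -> Y^T = Y ->
  2 * \tr ((X - Y) *m (X ^+ p.*2.+1 - Y ^+ p.*2.+1))
    <= p.*2.+1%:R * \tr ((X - Y) *m (X - Y) *m (X ^+ p.*2 + Y ^+ p.*2)).
Proof.
move=> symX symY.
have [lam [mu [w [w0 _ trE]]]] := trace_exp_mul_spectral symX symY.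
(* Cyclicity reduces the words met below to a power of [X] times a power of [Y]; an exponent 0
   stands for an absent factor. *)
have trXY a b c :
    \tr (X ^+ a *m Y ^+ b *m X ^+ c) = \tr (X ^+ (a + c) *m Y ^+ b).
  by rewrite mxtrace_mulC mulmxA mulmx_expD addnC.
have trYX a b c :
    \tr (Y ^+ a *m X ^+ b *m Y ^+ c) = \tr (X ^+ b *m Y ^+ (a + c)).
  by rewrite mxtrace_mulC mulmxA mulmx_expD mxtrace_mulC addnC.
have -> : \tr ((X - Y) *m (X ^+ p.*2.+1 - Y ^+ p.*2.+1))
    = \sum_i \sum_j w i j *
        ((lam i - mu j) * (lam i ^+ p.*2.+1 - mu j ^+ p.*2.+1)).
  transitivity (\tr (X ^+ p.*2.+2 *m Y ^+ 0) - \tr (X ^+ 1 *m Y ^+ p.*2.+1)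
      - \tr (X ^+ p.*2.+1 *m Y ^+ 1) + \tr (X ^+ 0 *m Y ^+ p.*2.+2)).
    rewrite !expr0 !expr1 mulmx1 mul1mx mulmxBl !mulmxBr !mxtraceB.
    rewrite !mulmx_expS.
    rewrite (mxtrace_mulC Y); ring.
  rewrite !trE -!sumrN -!big_split; apply: eq_bigr => i _.
  rewrite -!sumrN -!big_split; apply: eq_bigr => j _ /=.
  rewrite !exprS; ring.
have -> : \tr ((X - Y) *m (X - Y) *m (X ^+ p.*2 + Y ^+ p.*2))
    = \sum_i \sum_j w i j *
        ((lam i - mu j) ^+ 2 * (lam i ^+ p.*2 + mu j ^+ p.*2)).
  transitivity (\tr (X ^+ p.*2.+2 *m Y ^+ 0) - 2 * \tr (X ^+ p.*2.+1 *m Y ^+ 1)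
      + \tr (X ^+ p.*2 *m Y ^+ 2) + \tr (X ^+ 2 *m Y ^+ p.*2)
      - 2 * \tr (X ^+ 1 *m Y ^+ p.*2.+1) + \tr (X ^+ 0 *m Y ^+ p.*2.+2)).
    rewrite !expr0 !expr1 mulmx1 mul1mx mulmxDr mulmxBl !mulmxBr.
    rewrite !mulmxBl mxtraceD !mxtraceB.
    have h1 := trXY 1%N 1%N p.*2; have h2 := trXY 0%N 1%N p.*2.+1.
    have h3 := trXY 0%N 2%N p.*2.
    have h4 := trYX 1%N 1%N p.*2.
    move: h1 h2 h3 h4.
    rewrite !expr0 !expr1 !mul1mx ?add0n ?add1n.
    rewrite -!mulmx_expS !expr0 !mulmx1 ?mulmxA.
    move=> -> -> -> ->; ring.
  rewrite !trE !mulr_sumr -!sumrN -!big_split; apply: eq_bigr => i _.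
  rewrite !mulr_sumr -!sumrN -!big_split; apply: eq_bigr => j _ /=.
  rewrite !exprS; ring.
rewrite !mulr_sumr; apply: ler_sum => i _.
rewrite !mulr_sumr; apply: ler_sum => j _.
rewrite mulrCA [leRHS]mulrCA; apply: ler_wpM2l => //.
exact: mean_value_exp_odd.
Qed.

(** * Moments of sums of independent random projections *)

Definition ffun_upd (I : finType) (T : Type) (J : {ffun I -> T}) (s : I) (x : T)
  : {ffun I -> T} := [ffun t => if t == s then x else J t].

Definition iid_weight (F : comNzRingType) (m d : nat) (w : 'I_m -> F)
  (J : {ffun 'I_d -> 'I_m}) : F := \prod_(s < d) w (J s).

Definition iid_mean (F : comNzRingType) (m d : nat) (w : 'I_m -> F)
  (f : {ffun 'I_d -> 'I_m} -> F) : F := \sum_J iid_weight w J * f J.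

Lemma sum_iid_weight (F : comNzRingType) (m d : nat) (w : 'I_m -> F) :
  \sum_j w j = 1 -> \sum_(J : {ffun 'I_d -> 'I_m}) iid_weight w J = 1.
Proof.
move=> w1; rewrite -(bigA_distr_bigA (fun (s : 'I_d) j => w j)).
by rewrite big1.
Qed.

Lemma iid_weight_ge0 (F : numDomainType) (m d : nat) (w : 'I_m -> F)
    (J : {ffun 'I_d -> 'I_m}) :
  (forall j, 0 <= w j) -> 0 <= iid_weight w J.
Proof. by move=> w0; apply: prodr_ge0. Qed.

Lemma le_iid_mean (F : numDomainType) (m d : nat) (w : 'I_m -> F)
    (f g : {ffun 'I_d -> 'I_m} -> F) :
  (forall j, 0 <= w j) -> (forall J, f J <= g J) ->
  iid_mean w f <= iid_mean w g.
Proof.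
by move=> w0 fg; apply: ler_sum => J _; rewrite ler_wpM2l ?iid_weight_ge0.
Qed.

Lemma sum_iid_mean (F : comNzRingType) (m d : nat) (w : 'I_m -> F)
    (I : finType) (f : I -> {ffun 'I_d -> 'I_m} -> F) :
  \sum_i iid_mean w (f i) = iid_mean w (fun J => \sum_i f i J).
Proof.
by rewrite exchange_big; apply: eq_bigr => J _; rewrite -mulr_sumr.
Qed.

Lemma iid_meanD (F : comNzRingType) (m d : nat) (w : 'I_m -> F)
    (f g : {ffun 'I_d -> 'I_m} -> F) :
  iid_mean w (fun J => f J + g J) = iid_mean w f + iid_mean w g.
Proof. by rewrite -big_split; apply: eq_bigr => J _; rewrite mulrDr. Qed.

Lemma iid_meanZ (F : comNzRingType) (m d : nat) (w : 'I_m -> F) (a : F)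
    (f : {ffun 'I_d -> 'I_m} -> F) :
  iid_mean w (fun J => a * f J) = a * iid_mean w f.
Proof. by rewrite mulr_sumr; apply: eq_bigr => J _; rewrite mulrCA. Qed.

(** Exchangeability: with [j] an independent draw from [w], exchanging [j] with the entry [J s] is
    an involution on pairs that preserves their joint weight. *)
Lemma iid_mean_swap (F : comNzRingType) (m d : nat) (w : 'I_m -> F) (s : 'I_d)
    (h : {ffun 'I_d -> 'I_m} -> 'I_m -> F) :
  iid_mean w (fun J => \sum_j w j * h J j)
    = iid_mean w (fun J => \sum_j w j * h (ffun_upd J s j) (J s)).
Proof.
pose sw (u : {ffun 'I_d -> 'I_m} * 'I_m) := (ffun_upd u.1 s u.2, u.1 s).
have swK : involutive sw.
  move=> [J j]; rewrite /sw /=; congr (_, _); last by rewrite ffunE eqxx.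
  by apply/ffunP => t; rewrite !ffunE; case: eqP => // ->.
have pairE (g : {ffun 'I_d -> 'I_m} -> 'I_m -> F) :
    iid_mean w (fun J => \sum_j w j * g J j)
    = \sum_u iid_weight w u.1 * w u.2 * g u.1 u.2.
  rewrite -(pair_big xpredT xpredT (fun J j => iid_weight w J * w j * g J j)).
  apply: eq_bigr => J _; rewrite mulr_sumr.
  by apply: eq_bigr => j _; rewrite mulrA.
rewrite !pairE (reindex_inj (inv_inj swK)); apply: eq_bigr => -[J j] _ /=.
congr (_ * _); rewrite /iid_weight (bigD1 s) //= [in RHS](bigD1 s) //=.
rewrite ffunE eqxx.
rewrite [in LHS](eq_bigr (fun t => w (J t))); first by ring.
by move=> t /negPf ts; rewrite ffunE ts.
Qed.

(* For projections, [2 (P + Q) - (P - Q)^2 = (P + Q)^2]. *)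
Lemma mxtrace_sub_idempotent (F : realDomainType) (n : nat) (P Q X : 'M[F]_n)
    (p : nat) :
  P^T = P -> Q^T = Q -> X^T = X -> P *m P = P -> Q *m Q = Q ->
  \tr ((P - Q) *m (P - Q) *m X ^+ p.*2) <= 2 * \tr ((P + Q) *m X ^+ p.*2).
Proof.
move=> symP symQ symX PP QQ.
have /le_trans := mxtrace_sqr_ge0 ((P + Q) *m X ^+ p).
rewrite -subr_ge0; apply.
rewrite trmx_mul trmx_exp symX linearD /= symP symQ -mulmxA mxtrace_mulC.
rewrite -!mulmxA (mulmxA (X ^+ p)) mulmx_expD addnn.
rewrite mxtrace_mulC -mulmxA mxtrace_mulC.
rewrite !mulmxA [(P - Q) *m (P - Q)]mulmxBl !mulmxBr.
rewrite [(P + Q) *m (P + Q)]mulmxDl !mulmxDr PP QQ.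
rewrite !mulmxBl !mulmxDl !mxtraceB !mxtraceD; lra.
Qed.

Definition wsum (F : comNzRingType) (m n : nat) (w : 'I_m -> F)
  (G : 'I_m -> 'M[F]_n) : 'M[F]_n := \sum_j w j *: G j.

(** When [w] sums to 1 this is the random sum minus its expectation. Each summand is centred
    separately, so that resampling one index changes a single term. *)
Definition deviation (F : comNzRingType) (m n d : nat) (w : 'I_m -> F)
  (G : 'I_m -> 'M[F]_n) (J : {ffun 'I_d -> 'I_m}) : 'M[F]_n :=
  \sum_s (G (J s) - wsum w G).

Lemma trmx_wsum (F : comNzRingType) (m n : nat) (w : 'I_m -> F)
    (G : 'I_m -> 'M[F]_n) :
  (forall j, (G j)^T = G j) -> (wsum w G)^T = wsum w G.
Proof.
move=> symG; rewrite /wsum linear_sum; apply: eq_bigr => j _ /=.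
by rewrite linearZ /= symG.
Qed.

Lemma trmx_deviation (F : comNzRingType) (m n d : nat) (w : 'I_m -> F)
    (G : 'I_m -> 'M[F]_n) (J : {ffun 'I_d -> 'I_m}) :
  (forall j, (G j)^T = G j) -> (deviation w G J)^T = deviation w G J.
Proof.
move=> symG; rewrite /deviation linear_sum; apply: eq_bigr => s _ /=.
by rewrite linearB /= symG trmx_wsum.
Qed.

Lemma deviation_upd (F : comNzRingType) (m n d : nat) (w : 'I_m -> F)
    (G : 'I_m -> 'M[F]_n) (J : {ffun 'I_d -> 'I_m}) (s : 'I_d) (j : 'I_m) :
  deviation w G J - deviation w G (ffun_upd J s j) = G (J s) - G j.
Proof.
rewrite /deviation (bigD1 s) //= [X in _ - X](bigD1 s) //= ffunE eqxx.
rewrite (eq_bigr (fun t => G (ffun_upd J s j t) - wsum w G)).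
  by rewrite opprD addrACA subrr addr0 opprB addrA subrK.
by move=> t /negPf ts; rewrite ffunE ts.
Qed.

Lemma sum_weighted_trace (F : comNzRingType) (m n : nat) (w : 'I_m -> F)
    (G : 'I_m -> 'M[F]_n) (W : 'M[F]_n) :
  \sum_j w j * \tr (G j *m W) = \tr (wsum w G *m W).
Proof.
rewrite /wsum mulmx_suml linear_sum; apply: eq_bigr => j _ /=.
by rewrite -scalemxAl linearZ.
Qed.

(** Method of exchangeable pairs: the mean [wsum w G] is replaced by [G j] for a fresh index [j],
    the expression is symmetrised under the swap of [j] and [J s], and the trace form of the mean
    value inequality is applied to [X] and its resampled copy. *)
Lemma iid_mean_deviation_term (F : rcfType) (m n d : nat) (w : 'I_m -> F)
    (G : 'I_m -> 'M[F]_n) (s : 'I_d) (p : nat) :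
  (forall j, 0 <= w j) -> \sum_j w j = 1 ->
  (forall j, (G j)^T = G j) -> (forall j, G j *m G j = G j) ->
  iid_mean w (fun J : {ffun 'I_d -> 'I_m} =>
      \tr ((G (J s) - wsum w G) *m deviation w G J ^+ p.*2.+1))
    <= p.*2.+1%:R * iid_mean w (fun J : {ffun 'I_d -> 'I_m} =>
      \tr ((G (J s) + wsum w G) *m deviation w G J ^+ p.*2)).
Proof.
move=> w0 w1 symG GG.
set a := iid_mean w _; set b := iid_mean w _.
pose X (J : {ffun 'I_d -> 'I_m}) := deviation w G J.
have symX J : (X J)^T = X J by exact: trmx_deviation.
pose h (J : {ffun 'I_d -> 'I_m}) j := \tr ((G (J s) - G j) *m X J ^+ p.*2.+1).
pose q (J : {ffun 'I_d -> 'I_m}) j :=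
  \tr ((G (J s) - G j) *m (G (J s) - G j) *m X J ^+ p.*2).
have aE : a = iid_mean w (fun J : {ffun 'I_d -> 'I_m} => \sum_j w j * h J j).
  apply: eq_bigr => J _; congr (_ * _); rewrite mulmxBl linearB /=.
  under [RHS]eq_bigr do rewrite /h mulmxBl linearB /= mulrBr.
  by rewrite sumrB -mulr_suml w1 mul1r sum_weighted_trace.
have bE : b = iid_mean w (fun J : {ffun 'I_d -> 'I_m} =>
    \sum_j w j * \tr ((G (J s) + G j) *m X J ^+ p.*2)).
  apply: eq_bigr => J _; congr (_ * _); rewrite mulmxDl linearD /=.
  under [RHS]eq_bigr do rewrite mulmxDl linearD /= mulrDr.
  by rewrite big_split -mulr_suml w1 mul1r sum_weighted_trace.
have h_upd J j : h (ffun_upd J s j) (J s)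
    = - \tr ((G (J s) - G j) *m X (ffun_upd J s j) ^+ p.*2.+1).
  by rewrite /h ffunE eqxx -linearN -mulNmx opprB.
have q_upd J j : q (ffun_upd J s j) (J s)
    = \tr ((G (J s) - G j) *m (G (J s) - G j) *m X (ffun_upd J s j) ^+ p.*2).
  by rewrite /q ffunE eqxx -(opprB (G (J s))) mulNmx mulmxN opprK.
(* The swap reverses the sign of [G (J s) - G j], so averaging the two forms of [a] produces a
   difference of powers; in [q2] below the increment is squared and the powers add up. *)
have a2 : a + a = iid_mean w (fun J : {ffun 'I_d -> 'I_m} => \sum_j w j *
    \tr ((X J - X (ffun_upd J s j)) *m
         (X J ^+ p.*2.+1 - X (ffun_upd J s j) ^+ p.*2.+1))).
  rewrite {1}aE aE [in X in _ + X](iid_mean_swap w s) -iid_meanD.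
  apply: eq_bigr => J _; congr (_ * _); rewrite -big_split.
  apply: eq_bigr => j _ /=.
  by rewrite -mulrDr h_upd /h deviation_upd mulmxBr linearB.
pose e := iid_mean w (fun J : {ffun 'I_d -> 'I_m} => \sum_j w j * q J j).
have q2 : e + e = iid_mean w (fun J : {ffun 'I_d -> 'I_m} => \sum_j w j *
    \tr ((X J - X (ffun_upd J s j)) *m (X J - X (ffun_upd J s j)) *m
         (X J ^+ p.*2 + X (ffun_upd J s j) ^+ p.*2))).
  rewrite /e [in X in _ + X](iid_mean_swap w s) -iid_meanD.
  apply: eq_bigr => J _; congr (_ * _); rewrite -big_split.
  apply: eq_bigr => j _ /=.
  by rewrite -mulrDr q_upd /q deviation_upd -mxtraceD -mulmxDr.
have qb : e <= 2 * b.
  rewrite bE -iid_meanZ; apply: le_iid_mean => // J.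
  rewrite mulr_sumr; apply: ler_sum => j _; rewrite mulrCA.
  by apply: ler_wpM2l => //; apply: mxtrace_sub_idempotent.
have aq : 2 * (a + a) <= p.*2.+1%:R * (e + e).
  rewrite a2 q2 -!iid_meanZ; apply: le_iid_mean => // J.
  rewrite !mulr_sumr; apply: ler_sum => j _; rewrite mulrCA [leRHS]mulrCA.
  by apply: ler_wpM2l => //; apply: mxtrace_mean_value.
have /(ler_wpM2l (ler0n F p.*2.+1)) := lerD qb qb.
lra.
Qed.

Lemma mxtrace_exp_double_ge0 (F : realDomainType) (n : nat) (X : 'M[F]_n)
    (p : nat) :
  X^T = X -> 0 <= \tr (X ^+ p.*2).
Proof.
move=> symX; have := mxtrace_sqr_ge0 (X ^+ p).
by rewrite trmx_exp symX mulmx_expD addnn.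
Qed.

(* From [tr (X^p (X - a))^2 >= 0]. *)
Lemma mxtrace_exp_odd_le (F : realDomainType) (n : nat) (X : 'M[F]_n) (a : F)
    (p : nat) :
  X^T = X ->
  2 * a * \tr (X ^+ p.*2.+1) <= a ^+ 2 * \tr (X ^+ p.*2) + \tr (X ^+ p.*2.+2).
Proof.
move=> symX; have /le_trans := mxtrace_sqr_ge0 (X ^+ p.+1 - a *: X ^+ p).
rewrite -subr_ge0; apply.
have -> : (X ^+ p.+1 - a *: X ^+ p)^T = X ^+ p.+1 - a *: X ^+ p.
  by rewrite linearB linearZ /= !trmx_exp symX.
rewrite mulmxBl !mulmxBr -!scalemxAl -!scalemxAr !mulmx_expD.
rewrite !linearB !linearZ /=.
rewrite !addSn !addnS addnn.
lra.
Qed.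

(** The left trace sums the quadratic form of [S] over the columns of [N]. *)
Lemma mxtrace_mul_sqr_le (F : realDomainType) (m n : nat) (S : 'M[F]_n)
    (N : 'M[F]_(n, m)) (kappa : F) :
  (forall x : 'cV_n, (x^T *m S *m x) 0 0 <= kappa * (x^T *m x) 0 0) ->
  \tr (N^T *m S *m N) <= kappa * \tr (N^T *m N).
Proof.
move=> hS; rewrite /mxtrace mulr_sumr; apply: ler_sum => i _.
have quadE (T : 'M[F]_n) :
      (N^T *m T *m N) i i = ((col i N)^T *m T *m col i N) 0 0.
  by rewrite tr_col -row_mul -row_mul colE mulmxA -colE !mxE.
have := quadE 1%:M; rewrite !mulmx1 => ->.
by rewrite quadE hS.
Qed.

(** Each [lam i ^+ p.*2] is one of the nonnegative terms of the trace, whence [|lam i| <= t]. The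
    quadratic form is then recovered from the joint spectral weights of [X] and [x *m x^T]. *)
Lemma quadratic_form_le_mxtrace (F : rcfType) (n : nat) (X : 'M[F]_n) (t : F)
    (p : nat) :
  X^T = X -> 0 <= t -> (0 < p)%N -> \tr (X ^+ p.*2) <= t ^+ p.*2 ->
  forall x : 'cV_n, `|(x^T *m X *m x) 0 0| <= t * (x^T *m x) 0 0.
Proof.
move=> symX t0 p0 trX x.
have symxx : (x *m x^T)^T = x *m x^T by rewrite trmx_mul trmxK.
have [lam [mu [w [w0 w1 trE]]]] := trace_exp_mul_spectral symX symxx.
have lamt i : `|lam i| <= t.
  rewrite -(@ler_pXn2r _ p.*2) ?nnegrE ?double_gt0 //.
  apply: le_trans trX; have := trE p.*2 0%N; rewrite expr0 mulmx1 => ->.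
  under eq_bigr do
    (under eq_bigr do rewrite expr0 mulr1; rewrite -mulr_suml w1 mul1r).
  rewrite (bigD1 i) //= -[leLHS]addr0 -mul2n !exprM.
  rewrite real_normK ?num_real // lerD2l.
  by apply: sumr_ge0 => k _; rewrite exprM exprn_ge0 // sqr_ge0.
(* Squaring [x *m x^T] makes its eigenvalues enter as [mu j ^+ 2 >= 0]; the extra factor [x^T *m x]
   is divided out once [x = 0] is set aside. *)
have trx (Y : 'M[F]_n) : \tr (Y *m (x *m x^T) ^+ 2)
    = (x^T *m Y *m x) 0 0 * (x^T *m x) 0 0.
  rewrite expr2 -mulmxE !mulmxA mxtrace_mulC !mulmxA -(mulmxA _ x^T x).
  by rewrite [x^T *m x]mx11_scalar mul_mx_scalar linearZ /= trace_mx11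
    mulrC -mx11_scalar.
have xx0 : 0 <= (x^T *m x) 0 0.
  by rewrite -trace_mx11 mxtrace_sqr_ge0.
have [/trmx_mul_self_eq0 ->|xn0] := eqVneq ((x^T *m x) 0 0) 0.
  by rewrite !mulmx0 mxE normr0 mulr0.
rewrite -(ler_pM2r (x := (x^T *m x) 0 0)) ?lt_def ?xn0 //.
have tr1 := trE 1%N 2; have tr0 := trE 0%N 2.
rewrite expr1 trx in tr1; rewrite expr0 trx mulmx1 in tr0.
rewrite -[X in _ * X <= _](ger0_norm xx0) -normrM -mulrA tr1 tr0.
apply: le_trans (ler_norm_sum _ _ _) _.
rewrite mulr_sumr; apply: ler_sum => i _.
apply: le_trans (ler_norm_sum _ _ _) _.
rewrite mulr_sumr; apply: ler_sum => j _.
rewrite normrM (ger0_norm (w0 i j)) [leRHS]mulrCA ler_wpM2l //.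
rewrite normrM [`|mu j ^+ 2|]ger0_norm ?sqr_ge0 // expr1 expr0 mul1r.
by rewrite ler_wpM2r ?sqr_ge0.
Qed.

(** Summed over [s], the centred factors [G (J s) - wsum w G] rebuild one more factor of the
    deviation. *)
Lemma iid_mean_trace_step (F : rcfType) (m n d : nat) (w : 'I_m -> F)
    (G : 'I_m -> 'M[F]_n) (p : nat) :
  (forall j, 0 <= w j) -> \sum_j w j = 1 ->
  (forall j, (G j)^T = G j) -> (forall j, G j *m G j = G j) ->
  iid_mean w (fun J : {ffun 'I_d -> 'I_m} => \tr (deviation w G J ^+ p.*2.+2))
    <= p.*2.+1%:R * iid_mean w (fun J : {ffun 'I_d -> 'I_m} =>
      \sum_s \tr ((G (J s) + wsum w G) *m deviation w G J ^+ p.*2)).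
Proof.
move=> w0 w1 symG GG; rewrite -[X in _ <= _ * X]sum_iid_mean mulr_sumr.
rewrite [leLHS](_ : _ = \sum_s iid_mean w (fun J : {ffun 'I_d -> 'I_m} =>
      \tr ((G (J s) - wsum w G) *m deviation w G J ^+ p.*2.+1))).
  by apply: ler_sum => s _; apply: iid_mean_deviation_term.
rewrite sum_iid_mean; apply: eq_bigr => J _; congr (_ * _).
by rewrite -linear_sum -mulmx_suml /= -/(deviation w G J) mulmx_expS.
Qed.

(** Case [p = 0] of the step: only traces of [G] and of its mean remain, each at most 1, which keeps
    the dimension out of the bound. *)
Lemma iid_mean_trace_sqr (F : rcfType) (m n d : nat) (w : 'I_m -> F)
    (G : 'I_m -> 'M[F]_n) :
  (forall j, 0 <= w j) -> \sum_j w j = 1 ->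
  (forall j, (G j)^T = G j) -> (forall j, G j *m G j = G j) ->
  (forall j, \tr (G j) <= 1) ->
  iid_mean w (fun J : {ffun 'I_d -> 'I_m} => \tr (deviation w G J ^+ 2))
    <= 2 * d%:R.
Proof.
move=> w0 w1 symG GG trG.
have trS : \tr (wsum w G) <= 1.
  rewrite -[wsum w G]mulmx1 -sum_weighted_trace -[leRHS]w1.
  by apply: ler_sum => j _; rewrite mulmx1 ler_piMr.
apply: le_trans (iid_mean_trace_step d 0 w0 w1 symG GG) _.
rewrite mul1r -[leRHS]mul1r -[X in _ <= X * _](sum_iid_weight d w1) mulr_suml.
apply: ler_sum => J _; rewrite ler_wpM2l ?iid_weight_ge0 //.
rewrite mulr_natr -[X in _ *+ X](card_ord d) -sumr_const.
apply: ler_sum => s _; rewrite expr0 mulmx1 linearD /=.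
by have := trG (J s); lra.
Qed.

(** The factors [G (J s) + wsum w G] add up to [X + 2 d wsum w G]. The odd power of [X] is absorbed
    by [mxtrace_exp_odd_le] with parameter [2p+1], and the mean is controlled by [kappa]. *)
Lemma iid_mean_trace_recursion (F : rcfType) (m n d : nat) (w : 'I_m -> F)
    (G : 'I_m -> 'M[F]_n) (kappa : F) (p : nat) :
  (forall j, 0 <= w j) -> \sum_j w j = 1 ->
  (forall j, (G j)^T = G j) -> (forall j, G j *m G j = G j) ->
  (forall x : 'cV_n, (x^T *m wsum w G *m x) 0 0 <= kappa * (x^T *m x) 0 0) ->
  iid_mean w (fun J : {ffun 'I_d -> 'I_m} => \tr (deviation w G J ^+ p.*2.+2))
    <= p.*2.+1%:R * (p.*2.+1%:R + 4 * (d%:R * kappa))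
      * iid_mean w (fun J : {ffun 'I_d -> 'I_m} =>
          \tr (deviation w G J ^+ p.*2)).
Proof.
move=> w0 w1 symG GG hS; set k := p.*2.+1%:R.
have := iid_mean_trace_step d p w0 w1 symG GG.
rewrite -/k; set a := iid_mean w _; set b := iid_mean w _.
set c := iid_mean w _.
(* Together with [a <= k * b] this bounds [2 * a] by an expression containing [a] once, which
   cancels. *)
suff : 2 * k * b <= k ^+ 2 * c + a + 4 * (d%:R * kappa) * k * c by lra.
rewrite /a /b /c -!iid_meanZ -!iid_meanD; apply: le_iid_mean => // J.
set X := deviation w G J.
have symX : X^T = X by exact: trmx_deviation.
have -> : \sum_s \tr ((G (J s) + wsum w G) *m X ^+ p.*2)
    = \tr (X ^+ p.*2.+1) + 2 * d%:R * \tr (wsum w G *m X ^+ p.*2).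
  transitivity (\sum_(s < d) (\tr ((G (J s) - wsum w G) *m X ^+ p.*2)
      + 2 * \tr (wsum w G *m X ^+ p.*2))).
    apply: eq_bigr => s _; rewrite mulmxDl mulmxBl linearD linearB /=; ring.
  rewrite big_split sumr_const card_ord /= -linear_sum -mulmx_suml /=.
  by rewrite -/(deviation w G J) -/X mulmx_expS -mulr_natr; ring.
have h1 := mxtrace_exp_odd_le k p symX.
have := mxtrace_mul_sqr_le (X ^+ p) hS.
rewrite trmx_exp symX mulmx_expD addnn mxtrace_mulC mulmxA mulmx_expD addnn.
rewrite mxtrace_mulC => h2.
have kd : 0 <= 4 * d%:R * k by rewrite !mulr_ge0.
have := ler_wpM2l kd h2; lra.
Qed.

(** The recursion is iterated from the second moment. Below order [p] its multiplier [k (k + 4 K)],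
    with [K = d kappa], is at most [12 p K], because [k <= 2 p] and [p <= K] give
    [k + 4 K <= 6 K]. *)
Lemma iid_mean_trace_exp_le (F : rcfType) (m n d : nat) (w : 'I_m -> F)
    (G : 'I_m -> 'M[F]_n) (kappa : F) (p q : nat) :
  (forall j, 0 <= w j) -> \sum_j w j = 1 ->
  (forall j, (G j)^T = G j) -> (forall j, G j *m G j = G j) ->
  (forall j, \tr (G j) <= 1) ->
  (forall x : 'cV_n, (x^T *m wsum w G *m x) 0 0 <= kappa * (x^T *m x) 0 0) ->
  p%:R <= d%:R * kappa -> (q < p)%N ->
  iid_mean w (fun J : {ffun 'I_d -> 'I_m} => \tr (deviation w G J ^+ q.+1.*2))
    <= 2 * d%:R * (12 * p%:R * (d%:R * kappa)) ^+ q.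
Proof.
move=> w0 w1 symG GG trG hS pK; elim: q => [|q IH] qp.
  by rewrite expr0 mulr1; apply: iid_mean_trace_sqr.
apply: le_trans (iid_mean_trace_recursion d q.+1 w0 w1 symG GG hS) _.
set K := d%:R * kappa in pK IH *; set M := iid_mean w _.
have K0 : 0 <= K by apply: le_trans pK.
have M0 : 0 <= M.
  apply: sumr_ge0 => J _; rewrite mulr_ge0 ?iid_weight_ge0 //.
  by rewrite mxtrace_exp_double_ge0 // trmx_deviation.
have kp : q.+1.*2.+1%:R <= 2 * p%:R :> F.
  by rewrite -natrM mul2n ler_nat ltn_double.
apply: (@le_trans _ _ (12 * p%:R * K * M)).
  apply: ler_wpM2r => //.
  apply: (@le_trans _ _ (2 * p%:R * (q.+1.*2.+1%:R + 4 * K))).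
    by apply: ler_wpM2r => //; have := ler0n F q.+1.*2.+1; lra.
  rewrite (_ : 12 * p%:R * K = 2 * p%:R * (6 * K)); last by ring.
  by apply: ler_wpM2l; [rewrite mulr_ge0|lra].
rewrite exprS [leRHS]mulrCA; apply: ler_wpM2l.
  by rewrite mulr_ge0 // mulr_ge0.
by apply: IH; apply: ltnW.
Qed.

(** * Norms and eigenvalues *)

(** Cauchy-Schwarz, by Lagrange's identity. *)
Lemma sqr_sum_mul_le (F : realDomainType) (n : nat) (a b : 'I_n -> F) :
  (\sum_i a i * b i) ^+ 2 <= (\sum_i a i ^+ 2) * (\sum_i b i ^+ 2).
Proof.
have : 0 <= \sum_i \sum_j (a i * b j - a j * b i) ^+ 2.
  by apply: sumr_ge0 => i _; apply: sumr_ge0 => j _; apply: sqr_ge0.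
have -> : \sum_i \sum_j (a i * b j - a j * b i) ^+ 2
    = 2 * ((\sum_i a i ^+ 2) * (\sum_i b i ^+ 2)) - 2 * (\sum_i a i * b i) ^+ 2.
  have distr (f g : 'I_n -> F) :
      (\sum_i f i) * (\sum_i g i) = \sum_i \sum_j f i * g j.
    by rewrite mulr_suml; apply: eq_bigr => i _; rewrite mulr_sumr.
  rewrite mulr_natl mulr2n {2}[_ * \sum_i b i ^+ 2]mulrC expr2 !distr mulr_sumr.
  rewrite -big_split -sumrB; apply: eq_bigr => i _ /=.
  rewrite mulr_sumr -big_split -sumrB; apply: eq_bigr => j _ /=; ring.
by rewrite subr_ge0 ler_pM2l.
Qed.

Lemma vnorm_ge0 (n : nat) (x : 'cV[R]_n) : 0 <= vnorm x.
Proof. exact: sqrtr_ge0. Qed.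

Lemma sqr_vnorm (n : nat) (x : 'cV[R]_n) : vnorm x ^+ 2 = (x^T *m x) 0 0.
Proof.
rewrite sqr_sqrtr; last by apply: sumr_ge0 => i _; apply: sqr_ge0.
by rewrite mxE; apply: eq_bigr => i _; rewrite mxE expr2.
Qed.

Lemma vnorm0 (n : nat) : vnorm (0 : 'cV[R]_n) = 0.
Proof. by apply/eqP; rewrite -sqrf_eq0 sqr_vnorm mulmx0 mxE. Qed.

Lemma vnorm_eq0 (n : nat) (x : 'cV[R]_n) : vnorm x = 0 -> x = 0.
Proof.
move=> /(congr1 (fun a => a ^+ 2)); rewrite sqr_vnorm expr0n /=.
exact: trmx_mul_self_eq0.
Qed.

Lemma vnormZ (n : nat) (a : R) (x : 'cV[R]_n) : vnorm (a *: x) = `|a| * vnorm x.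
Proof.
apply/eqP; rewrite -(@eqrXn2 _ 2) ?mulr_ge0 ?vnorm_ge0 // exprMn !sqr_vnorm.
by rewrite -scalemxAr [_^T]linearZ /= -scalemxAl !mxE mulrA -expr2 real_normK
  ?num_real.
Qed.

Lemma frob_ge0 (m n : nat) (M : 'M[R]_(m, n)) : 0 <= frob M.
Proof. exact: sqrtr_ge0. Qed.

Lemma sqr_frob (m n : nat) (M : 'M[R]_(m, n)) :
  frob M ^+ 2 = \sum_j \sum_i M j i ^+ 2.
Proof.
rewrite sqr_sqrtr //.
by apply: sumr_ge0 => j _; apply: sumr_ge0 => i _; apply: sqr_ge0.
Qed.

Lemma vnorm_mul_le_frob (m n : nat) (M : 'M[R]_(m, n)) (x : 'cV[R]_n) :
  vnorm (M *m x) <= frob M * vnorm x.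
Proof.
rewrite -(@ler_pXn2r _ 2) ?nnegrE ?mulr_ge0 ?vnorm_ge0 ?frob_ge0 //.
rewrite exprMn sqr_frob !sqr_vnorm mxE mulr_suml; apply: ler_sum => j _.
rewrite !mxE -expr2; under [X in _ <= _ * X]eq_bigr do rewrite mxE -expr2.
exact: sqr_sum_mul_le.
Qed.

(** This makes the [sup] in [opnorm] a genuine least upper bound; the Frobenius norm bounds the
    set. *)
Lemma opnorm_has_sup (m n : nat) (M : 'M[R]_(m, n)) :
  has_sup [set vnorm (M *m x) | x in [set x : 'cV[R]_n | vnorm x <= 1]].
Proof.
split; first by exists (vnorm (M *m 0)), 0 => //=; rewrite vnorm0.
exists (frob M) => _ /= [x x1 <-]; apply: le_trans (vnorm_mul_le_frob M x) _.
by rewrite ler_piMr ?frob_ge0.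
Qed.

Lemma opnorm_le (m n : nat) (M : 'M[R]_(m, n)) (b : R) :
  (forall x : 'cV[R]_n, vnorm x <= 1 -> vnorm (M *m x) <= b) -> opnorm M <= b.
Proof.
move=> hb; apply: ge_sup; first by case: (opnorm_has_sup M).
by move=> _ /= [x x1 <-]; apply: hb.
Qed.

Lemma opnorm_ge0 (m n : nat) (M : 'M[R]_(m, n)) : 0 <= opnorm M.
Proof.
have := sup_upper_bound (opnorm_has_sup M); apply => /=.
by exists 0; rewrite ?mulmx0 /= ?vnorm0.
Qed.

Lemma opnorm_le_frob (m n : nat) (M : 'M[R]_(m, n)) : opnorm M <= frob M.
Proof.
apply: opnorm_le => x x1; apply: le_trans (vnorm_mul_le_frob M x) _.
by rewrite ler_piMr ?frob_ge0.
Qed.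

Lemma vnorm_mul_le_opnorm (m n : nat) (M : 'M[R]_(m, n)) (x : 'cV[R]_n) :
  vnorm (M *m x) <= opnorm M * vnorm x.
Proof.
have [/vnorm_eq0 ->|x0] := eqVneq (vnorm x) 0.
  by rewrite mulmx0 !vnorm0 mulr0.
have xp : 0 < vnorm x by rewrite lt_def x0 vnorm_ge0.
rewrite -ler_pdivrMr //.
have := sup_upper_bound (opnorm_has_sup M); apply => /=.
exists ((vnorm x)^-1 *: x).
  by rewrite /= vnormZ ger0_norm ?invr_ge0 ?vnorm_ge0 // mulVf.
by rewrite -scalemxAr vnormZ ger0_norm ?invr_ge0 ?vnorm_ge0 // mulrC.
Qed.

Lemma opnorm_gt0 (m n : nat) (M : 'M[R]_(m, n)) : M != 0 -> 0 < opnorm M.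
Proof.
move=> M0; rewrite lt_def opnorm_ge0 andbT; apply: contra_neq M0 => o0.
apply/matrixP => i j; have := vnorm_mul_le_opnorm M (delta_mx j 0).
rewrite o0 mul0r => h; have /vnorm_eq0 : vnorm (M *m delta_mx j 0) = 0.
  by apply/eqP; rewrite eq_le h vnorm_ge0.
by rewrite -colE => /colP/(_ i); rewrite !mxE.
Qed.

Lemma eig_quadratic_form (n : nat) (S V : 'M[R]_n) (lam : 'I_n -> R)
    (x : 'cV[R]_n) :
  eig_decomp S V lam ->
  (x^T *m S *m x) 0 0 = \sum_i lam i * (V^T *m x) i 0 ^+ 2.
Proof.
case=> _ -> _; rewrite -!mulmxA mulmxA -[x^T *m V]trmxK trmx_mul trmxK mxE.
by apply: eq_bigr => i _; rewrite mul_diag_mx !mxE; ring.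
Qed.

Lemma eig_sqr_vnorm (n : nat) (S V : 'M[R]_n) (lam : 'I_n -> R) (x : 'cV[R]_n) :
  eig_decomp S V lam -> (x^T *m x) 0 0 = \sum_i (V^T *m x) i 0 ^+ 2.
Proof.
case=> /mulmx1C VV _ _; rewrite -{2}[x]mul1mx -VV -mulmxA mulmxA.
rewrite -[x^T *m V]trmxK trmx_mul trmxK mxE.
by apply: eq_bigr => i _; rewrite mxE expr2.
Qed.

Lemma gram_quadratic_form (m n : nat) (B : 'M[R]_(m, n)) (x : 'cV[R]_n) :
  (x^T *m (B^T *m B) *m x) 0 0 = vnorm (B *m x) ^+ 2.
Proof. by rewrite sqr_vnorm trmx_mul !mulmxA. Qed.

Lemma eig_gram_ge0 (m n : nat) (B : 'M[R]_(m, n)) (V : 'M[R]_n)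
    (lam : 'I_n -> R) (i : 'I_n) :
  eig_decomp (B^T *m B) V lam -> 0 <= lam i.
Proof.
move=> h; have VV : V^T *m col i V = delta_mx i 0.
  by case: h => VV _ _; rewrite colE mulmxA VV mul1mx.
have := eig_quadratic_form (col i V) h; rewrite gram_quadratic_form.
rewrite VV (bigD1 i) //= big1 => [|j /negPf ji].
  by rewrite !mxE !eqxx expr1n mulr1 addr0 => <-; apply: sqr_ge0.
by rewrite !mxE ji expr0n mulr0.
Qed.

(* A vector satisfying [V^T x]_j = 0 for j > i and [W^T x]_j = 0 for j < i is
   constrained by only [n - 1] linear equations. *)
Lemma eig_perturbation (n : nat) (S V T W : 'M[R]_n) (lam mu : 'I_n -> R)
    (tau t : R) :
  eig_decomp S V lam -> eig_decomp T W mu -> 0 <= tau ->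
  (forall x : 'cV[R]_n, (x^T *m S *m x) 0 0
     <= tau * (x^T *m T *m x) 0 0 + t * (x^T *m x) 0 0) ->
  forall i, lam i <= tau * mu i + t.
Proof.
move=> hS hT tau0 hST i.
(* Row [i] of [M] is zero, so [M] is singular; a kernel vector satisfies all the constraints at
   once. *)
pose M : 'M[R]_n := \matrix_(j, l)
  (if (i < j)%N then V^T j l else if (j < i)%N then W^T j l else 0).
have /det0P[y y0 yM] : \det M^T == 0.
  rewrite det_tr; apply/det0P; exists (delta_mx 0 i).
    by apply/eqP => /rowP/(_ i)/eqP; rewrite !mxE !eqxx oner_eq0.
  by rewrite -rowE; apply/rowP => l; rewrite !mxE ltnn.
pose x := y^T.
have Mx j : (M *m x) j 0 = 0.
  by rewrite -[M]trmxK -trmx_mul yM !mxE.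
have MxE (N : 'M[R]_n) j : (forall l, M j l = N j l) -> (N *m x) j 0 = 0.
  by move=> MN; rewrite -(Mx j) !mxE; apply: eq_bigr => l _; rewrite MN.
have Vx (j : 'I_n) : (i < j)%N -> (V^T *m x) j 0 = 0.
  by move=> ij; apply: MxE => l; rewrite !mxE ij.
have Wx (j : 'I_n) : (j < i)%N -> (W^T *m x) j 0 = 0.
  by move=> ji; apply: MxE => l; rewrite mxE ltnNge (ltnW ji) /= ji.
(* On [x] only the eigenvalues [lam j] with [j <= i] and [mu j] with [j >= i] contribute, and both
   families are nonincreasing. *)
have low : lam i * (x^T *m x) 0 0 <= (x^T *m S *m x) 0 0.
  rewrite (eig_quadratic_form x hS) (eig_sqr_vnorm x hS) mulr_sumr.
  apply: ler_sum => j _; have [/Vx ->|ji] := ltnP i j.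
    by rewrite expr0n !mulr0.
  by rewrite ler_wpM2r ?sqr_ge0 //; case: hS => _ _; apply.
have high : (x^T *m T *m x) 0 0 <= mu i * (x^T *m x) 0 0.
  rewrite (eig_quadratic_form x hT) (eig_sqr_vnorm x hT) mulr_sumr.
  apply: ler_sum => j _; have [/Wx ->|ij] := ltnP j i.
    by rewrite expr0n !mulr0.
  by rewrite ler_wpM2r ?sqr_ge0 //; case: hT => _ _; apply.
have x0 : 0 < (x^T *m x) 0 0.
  rewrite -sqr_vnorm exprn_gt0 // lt_def vnorm_ge0 andbT.
  by apply: contra_neq y0 => /vnorm_eq0 /(congr1 trmx); rewrite trmxK trmx0.
rewrite -(ler_pM2r x0); apply: le_trans low _; apply: le_trans (hST x) _.
by rewrite mulrDl lerD2r -mulrA ler_wpM2l.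
Qed.

(** * Approximation error of the spectral projections *)

Lemma proj_kE (n : nat) (V : 'M[R]_n) (lam : 'I_n -> R) (k : nat) :
  proj_k V lam k = V *m diag_mx (\row_i ((i < k)%N && (0 < lam i))%:R) *m V^T.
Proof.
apply/matrixP => a b; rewrite /proj_k summxE mxE big_mkcond /=.
apply: eq_bigr => i _; rewrite mul_mx_diag !mxE.
case: ifP => _; last by rewrite mulr0 mul0r.
by rewrite big_ord1 !mxE mulr1.
Qed.

(** For [y = x - P_k x] and [s] the singular value in the bound, [tau |A y|^2 <= |B y|^2 + t |y|^2
    <= (tau s^2 + 2 t) |y|^2]: one [t] comes from passing from [A] to [B], the other from comparing
    eigenvalues. *)
Lemma opnorm_proj_k_le (m n d : nat) (A : 'M[R]_(m, n)) (B : 'M[R]_(d, n))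
    (VA V : 'M[R]_n) (lamA lam : 'I_n -> R) (tau t : R) (k : nat) :
  eig_decomp (A^T *m A) VA lamA -> eig_decomp (B^T *m B) V lam ->
  0 < tau -> 0 <= t ->
  (forall x : 'cV[R]_n,
     `|(x^T *m (B^T *m B - tau *: (A^T *m A)) *m x) 0 0|
       <= t * (x^T *m x) 0 0) ->
  opnorm (A - A *m proj_k V lam k)
    <= sing_val lamA k.+1 + Num.sqrt (2 * t / tau).
Proof.
move=> hA hB tau0 t0 hx.
have quadE (x : 'cV[R]_n) : (x^T *m (B^T *m B - tau *: (A^T *m A)) *m x) 0 0
    = (x^T *m (B^T *m B) *m x) 0 0 - tau * (x^T *m (A^T *m A) *m x) 0 0.
  rewrite mulmxBr mulmxBl -scalemxAr -scalemxAl.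
  by rewrite [LHS]mxE [in X in _ + X]mxE [in X in _ - X]mxE.
have le1 (x : 'cV[R]_n) : (x^T *m (B^T *m B) *m x) 0 0
    <= tau * (x^T *m (A^T *m A) *m x) 0 0 + t * (x^T *m x) 0 0.
  by have := hx x; rewrite quadE ler_norml => /andP[_]; lra.
have le2 (x : 'cV[R]_n) : tau * (x^T *m (A^T *m A) *m x) 0 0
    <= (x^T *m (B^T *m B) *m x) 0 0 + t * (x^T *m x) 0 0.
  by have := hx x; rewrite quadE ler_norml => /andP[+ _]; lra.
have sv0 : 0 <= sing_val lamA k.+1.
  rewrite /sing_val /=; have [kn|nk] := ltnP k n.
    by rewrite (nth_map (Ordinal kn)) ?size_enum_ord // sqrtr_ge0.
  by rewrite nth_default // size_map size_enum_ord.
(* Ordinals count from 0, so position [k] holds the singular value numbered [k+1]. For [k >= n]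
   there is no such [i], and [sing_val] takes its default 0. *)
have lam_le (i : 'I_n) :
    (k <= i)%N -> lam i <= tau * sing_val lamA k.+1 ^+ 2 + t.
  move=> ki; have kn : (k < n)%N by exact: leq_ltn_trans (ltn_ord i).
  rewrite /sing_val /= (nth_map (Ordinal kn)) ?size_enum_ord //.
  rewrite (_ : nth _ _ k = Ordinal kn); last first.
    by apply: val_inj; rewrite /= nth_enum_ord.
  rewrite sqr_sqrtr ?(eig_gram_ge0 _ hA) //.
  apply: le_trans (eig_perturbation hB hA (ltW tau0) le1 (Ordinal kn)).
  by case: hB => _ _; apply.
apply: opnorm_le => x x1; pose y := x - proj_k V lam k *m x.
have -> : (A - A *m proj_k V lam k) *m x = A *m y.
  by rewrite mulmxBl mulmxBr mulmxA.
have Vy i : (V^T *m y) i 0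
    = if (i < k)%N && (0 < lam i) then 0 else (V^T *m x) i 0.
  rewrite /y proj_kE mulmxBr -!mulmxA (mulmxA V^T V); have [-> _ _] := hB.
  rewrite mul1mx mul_diag_mx !mxE; case: ifP => _; first by rewrite mul1r subrr.
  by rewrite mul0r subr0.
have yy : (y^T *m y) 0 0 <= 1.
  apply: (@le_trans _ _ ((x^T *m x) 0 0)); last first.
    by rewrite -sqr_vnorm expr_le1 ?vnorm_ge0.
  rewrite !(eig_sqr_vnorm _ hB); apply: ler_sum => i _; rewrite Vy.
  by case: ifP => _ //; rewrite expr0n sqr_ge0.
set s := sing_val lamA k.+1 in sv0 lam_le *.
have beta0 : 0 <= tau * s ^+ 2 + t.
  by rewrite addr_ge0 // mulr_ge0 ?sqr_ge0 // ltW.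
(* Coordinates with [i >= k] are bounded by [lam_le]; those with [i < k] are either removed by the
   projection or carry [lam i <= 0]. *)
have By : (y^T *m (B^T *m B) *m y) 0 0 <= (tau * s ^+ 2 + t) * (y^T *m y) 0 0.
  rewrite (eig_quadratic_form y hB) (eig_sqr_vnorm y hB) mulr_sumr.
  apply: ler_sum => i _; have [/lam_le|ik] := leqP k i.
    by move=> h; rewrite ler_wpM2r ?sqr_ge0.
  have [li|li] := ltP 0 (lam i); first by rewrite Vy ik li expr0n !mulr0.
  by rewrite ler_wpM2r ?sqr_ge0 // (le_trans li).
have Ay : vnorm (A *m y) ^+ 2 <= s ^+ 2 + 2 * t / tau.
  rewrite -(ler_pM2l tau0) -gram_quadratic_form; apply: le_trans (le2 y) _.
  rewrite mulrDr [tau * (_ / _)]mulrCA mulfV ?gt_eqF // mulr1.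
  apply: le_trans (_ : (tau * s ^+ 2 + 2 * t) * (y^T *m y) 0 0 <= _).
    by lra.
  by rewrite ler_piMr // addr_ge0 ?mulr_ge0 ?sqr_ge0 // ltW.
have q0 : 0 <= 2 * t / tau by rewrite divr_ge0 ?mulr_ge0 // ltW.
(* Subadditivity of the square root, by comparing squares. *)
rewrite -(@ler_pXn2r _ 2) ?nnegrE ?vnorm_ge0 ?addr_ge0 ?sqrtr_ge0 //.
apply: le_trans Ay _; rewrite sqrrD sqr_sqrtr //.
by rewrite lerD2r lerDl mulrn_wge0 // mulr_ge0 ?sqrtr_ge0.
Qed.

(** * Row sampling *)

Lemma iid_markov (F : realFieldType) (m d : nat) (w : 'I_m -> F)
    (f : {ffun 'I_d -> 'I_m} -> F) (a : F) :
  (forall j, 0 <= w j) -> \sum_j w j = 1 -> (forall J, 0 <= f J) -> 0 < a ->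
  1 - iid_mean w f / a <= \sum_(J | f J <= a) iid_weight w J.
Proof.
move=> w0 w1 f0 a0; rewrite lerBlDr -{1}(sum_iid_weight d w1).
rewrite (bigID (fun J => f J <= a)) /= lerD2l ler_pdivlMr //.
apply: (@le_trans _ _ (\sum_(J | ~~ (f J <= a)) iid_weight w J * f J)).
  rewrite mulr_suml; apply: ler_sum => J; rewrite -ltNge => fJ.
  by rewrite ler_wpM2l ?iid_weight_ge0 // ltW.
rewrite /iid_mean [leRHS](bigID (fun J => f J <= a)) /= lerDr.
by apply: sumr_ge0 => J _; rewrite mulr_ge0 ?iid_weight_ge0.
Qed.

(** A zero row yields the zero vector, since division by zero gives 0; [row_proj] is then the zero
    projection. *)
Definition unit_row (m n : nat) (A : 'M[R]_(m, n)) (j : 'I_m) : 'cV[R]_n :=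
  \col_i (A j i / rownorm A j).

Definition row_proj (m n : nat) (A : 'M[R]_(m, n)) (j : 'I_m) : 'M[R]_n :=
  unit_row A j *m (unit_row A j)^T.

Lemma sqr_rownorm (m n : nat) (A : 'M[R]_(m, n)) (j : 'I_m) :
  rownorm A j ^+ 2 = \sum_i A j i ^+ 2.
Proof. by rewrite sqr_sqrtr //; apply: sumr_ge0 => i _; apply: sqr_ge0. Qed.

Lemma rownorm_eq0 (m n : nat) (A : 'M[R]_(m, n)) (j : 'I_m) (i : 'I_n) :
  rownorm A j = 0 -> A j i = 0.
Proof.
move=> /(congr1 (fun a => a ^+ 2)); rewrite sqr_rownorm expr0n /= => /eqP.
rewrite psumr_eq0; last by move=> l _; apply: sqr_ge0.
by move=> /allP/(_ i (mem_index_enum _)); rewrite sqrf_eq0 => /eqP.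
Qed.

Lemma unit_row_cases (m n : nat) (A : 'M[R]_(m, n)) (j : 'I_m) :
  unit_row A j = 0 \/ (unit_row A j)^T *m unit_row A j = 1%:M.
Proof.
have [r0|r0] := eqVneq (rownorm A j) 0; [left|right].
  by apply/colP => i; rewrite !mxE (rownorm_eq0 i r0) mul0r.
rewrite [LHS]mx11_scalar; congr _%:M; rewrite mxE.
rewrite -[RHS](@mulfV _ (rownorm A j ^+ 2)) ?sqrf_eq0 //.
rewrite {1}sqr_rownorm mulr_suml.
by apply: eq_bigr => i _; rewrite !mxE; field.
Qed.

Lemma trmx_row_proj (m n : nat) (A : 'M[R]_(m, n)) (j : 'I_m) :
  (row_proj A j)^T = row_proj A j.
Proof. by rewrite trmx_mul trmxK. Qed.

Lemma row_proj_idem (m n : nat) (A : 'M[R]_(m, n)) (j : 'I_m) :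
  row_proj A j *m row_proj A j = row_proj A j.
Proof.
rewrite /row_proj mulmxA -(mulmxA _ _ (unit_row A j)).
by have [->|->] := unit_row_cases A j; rewrite ?mulmx1 // !mul0mx.
Qed.

Lemma mxtrace_row_proj (m n : nat) (A : 'M[R]_(m, n)) (j : 'I_m) :
  \tr (row_proj A j) <= 1.
Proof.
rewrite /row_proj mxtrace_mulC.
have [->|->] := unit_row_cases A j; first by rewrite mulmx0 mxtrace0.
by rewrite mxtrace1.
Qed.

Lemma frob_gt0 (m n : nat) (A : 'M[R]_(m, n)) : A != 0 -> 0 < frob A.
Proof. by move=> /opnorm_gt0 /lt_le_trans; apply; apply: opnorm_le_frob. Qed.

Lemma row_prob_ge0 (m n : nat) (A : 'M[R]_(m, n)) (j : 'I_m) :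
  0 <= row_prob A j.
Proof. by rewrite divr_ge0 ?sqr_ge0. Qed.

Lemma sum_row_prob (m n : nat) (A : 'M[R]_(m, n)) :
  A != 0 -> \sum_j row_prob A j = 1.
Proof.
move=> /frob_gt0 f0; rewrite -mulr_suml.
under eq_bigr do rewrite sqr_rownorm.
by rewrite -sqr_frob mulfV // sqrf_eq0 gt_eqF.
Qed.

(** Sampling proportionally to squared row norms exactly undoes the normalisation of the rows. *)
Lemma wsum_row_proj (m n : nat) (A : 'M[R]_(m, n)) :
  wsum (row_prob A) (row_proj A) = (frob A ^+ 2)^-1 *: (A^T *m A).
Proof.
apply/matrixP => a b; rewrite summxE !mxE mulr_sumr; apply: eq_bigr => j _.
rewrite !mxE big_ord1 !mxE /row_prob.
have [r0|r0] := eqVneq (rownorm A j) 0.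
  by rewrite !(rownorm_eq0 _ r0) !(mul0r, mulr0).
by move: (frob A ^+ 2)^-1 => f; field.
Qed.

Lemma deviation_row_proj (m n d : nat) (A : 'M[R]_(m, n))
    (J : {ffun 'I_d -> 'I_m}) :
  deviation (row_prob A) (row_proj A) J
    = (sampled A J)^T *m sampled A J - (d%:R / frob A ^+ 2) *: (A^T *m A).
Proof.
rewrite /deviation sumrB sumr_const card_ord wsum_row_proj scalerMnl mulr_natl.
congr (_ - _); apply/matrixP => a b; rewrite summxE mxE.
by apply: eq_bigr => s _; rewrite !mxE big_ord1 !mxE.
Qed.

(** For nonzero [A] the constant is [1 / r]; it serves as [kappa] in the moment bounds. *)
Lemma wsum_row_proj_le (m n : nat) (A : 'M[R]_(m, n)) (x : 'cV[R]_n) :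
  (x^T *m wsum (row_prob A) (row_proj A) *m x) 0 0
    <= opnorm A ^+ 2 / frob A ^+ 2 * (x^T *m x) 0 0.
Proof.
rewrite wsum_row_proj -scalemxAr -scalemxAl mxE gram_quadratic_form -sqr_vnorm.
rewrite mulrAC -exprMn mulrC ler_wpM2r ?invr_ge0 ?sqr_ge0 //.
rewrite ler_pXn2r ?nnegrE ?mulr_ge0 ?vnorm_ge0 ?opnorm_ge0 //.
exact: vnorm_mul_le_opnorm.
Qed.

Lemma sample_prob_ge0 (m n d : nat) (A : 'M[R]_(m, n))
    (E : {ffun 'I_d -> 'I_m} -> Prop) : 0 <= sample_prob A E.
Proof.
by apply: sumr_ge0 => J _; apply: prodr_ge0 => s _; apply: row_prob_ge0.
Qed.

Lemma sample_prob_ge (m n d : nat) (A : 'M[R]_(m, n))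
    (b : pred {ffun 'I_d -> 'I_m}) (E : {ffun 'I_d -> 'I_m} -> Prop) :
  (forall J, b J -> E J) ->
  \sum_(J | b J) iid_weight (row_prob A) J <= sample_prob A E.
Proof.
move=> bE; rewrite /sample_prob big_mkcond [leRHS]big_mkcond /=.
apply: ler_sum => J _; case: ifP => [/bE/asboolP -> //|_].
by case: ifP => _ //; apply: prodr_ge0 => s _; apply: row_prob_ge0.
Qed.

(** Markov's inequality for the moment of order [2 (q+1)], followed by the deterministic bound
    [opnorm_proj_k_le]. *)
Lemma sampled_approximation_prob (m n d : nat) (A : 'M[R]_(m, n)) (eps : R)
    (q : nat) (VA : 'M[R]_n) (lamA : 'I_n -> R) :
  A != 0 -> 0 < eps ->
  let K := d%:R * (opnorm A ^+ 2 / frob A ^+ 2) in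
  q.+1%:R <= K ->
  eig_decomp (A^T *m A) VA lamA ->
  1 - 2 * d%:R * (12 * q.+1%:R * K) ^+ q / (eps ^+ 2 * K / 2) ^+ q.+1.*2 <=
  sample_prob A (fun J : {ffun 'I_d -> 'I_m} =>
    forall k : nat, (0 < k)%N ->
    forall (V : 'M[R]_n) (lam : 'I_n -> R),
      eig_decomp ((sampled A J)^T *m sampled A J) V lam ->
      opnorm (A - A *m proj_k V lam k) <= sing_val lamA k.+1 + eps * opnorm A).
Proof.
(* With [tau = d / |A|_F^2], this [t] is the value for which [2 t / tau = (eps |A|)^2]. *)
move=> A0 eps0 K qK hA; set t := eps ^+ 2 * K / 2.
have K0 : 0 < K by apply: lt_le_trans qK; rewrite ltr0n.
have t0 : 0 < t by rewrite divr_gt0 // mulr_gt0 // exprn_gt0.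
have f0 := frob_gt0 A0; have o0 := opnorm_gt0 A0.
have d0 : 0 < d%:R :> R.
  by move: K0; rewrite /K pmulr_lgt0 ?divr_gt0 ?exprn_gt0.
have w0 := row_prob_ge0 A; have w1 := sum_row_prob A0.
pose f (J : {ffun 'I_d -> 'I_m}) :=
  \tr (deviation (row_prob A) (row_proj A) J ^+ q.+1.*2).
have symX (J : {ffun 'I_d -> 'I_m}) :=
  trmx_deviation (row_prob A) J (trmx_row_proj A).
have := iid_mean_trace_exp_le w0 w1 (trmx_row_proj A) (row_proj_idem A)
  (mxtrace_row_proj A) (wsum_row_proj_le A) qK (ltnSn q).
rewrite -/K => Mle.
have fge J : 0 <= f J by apply: mxtrace_exp_double_ge0; apply: symX.
have tq0 : 0 < t ^+ q.+1.*2 by rewrite exprn_gt0.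
apply: (@le_trans _ _
  (\sum_(J | f J <= t ^+ q.+1.*2) iid_weight (row_prob A) J)).
  apply: le_trans (iid_markov w0 w1 fge tq0).
  by rewrite lerD2l lerN2 ler_pM2r ?invr_gt0.
(* The event on [f J] involves neither [k] nor the eigendecomposition, so the conclusion holds for
   all of them simultaneously. *)
apply: sample_prob_ge => J fJ k _ V lam hB.
have hx := quadratic_form_le_mxtrace (symX J) (ltW t0) (ltn0Sn q) fJ.
rewrite deviation_row_proj in hx.
have tau0 : 0 < d%:R / frob A ^+ 2 by rewrite divr_gt0 ?exprn_gt0.
apply: le_trans (opnorm_proj_k_le k hA hB tau0 (ltW t0) hx) _.
rewrite lerD2l (_ : 2 * t / _ = (eps * opnorm A) ^+ 2).
  by rewrite sqrtr_sqr ger0_norm // mulr_ge0 // ltW.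
by rewrite /t /K; field; rewrite !gt_eqF.
Qed.

(** * Choice of the moment order *)

Lemma moment_ratio_le (F : realFieldType) (r K eps : F) (q : nat) :
  0 < r -> 0 < K -> 0 < eps -> 192 * q.+1%:R <= eps ^+ 4 * K ->
  2 * (r * K) * (12 * q.+1%:R * K) ^+ q / (eps ^+ 2 * K / 2) ^+ q.+1.*2
    <= r * 4^-1 ^+ q.+1.
Proof.
move=> r0 K0 eps0 hp; set a := 12 * q.+1%:R * K; set e := eps ^+ 4 in hp.
have e0 : 0 < e by rewrite exprn_gt0.
pose b := e * K ^+ 2 / 4.
have b0 : 0 < b by rewrite divr_gt0 // mulr_gt0 // exprn_gt0.
have -> : (eps ^+ 2 * K / 2) ^+ q.+1.*2 = b ^+ q.+1.
  by rewrite -mul2n exprM; congr (_ ^+ _); rewrite /b /e; field.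
have a0 : 0 <= a by rewrite mulr_ge0 ?mulr_ge0 // ltW.
(* Here [a / b = 48 (q+1) / (eps^4 K)], and [192 = 4 * 48]. *)
have ab : a / b <= 4^-1.
  rewrite ler_pdivrMr // /a /b.
  by have := ler_wpM2r (ltW K0) hp; rewrite expr2; lra.
have q1 : 1 <= q.+1%:R :> F by rewrite ler1n.
have Kb : 2 * K / b <= 4^-1.
  rewrite ler_pdivrMr // /b.
  have h : 192 <= e * K by lra.
  by have := ler_wpM2r (ltW K0) h; rewrite expr2; lra.
have -> : 2 * (r * K) * a ^+ q / b ^+ q.+1 = r * ((2 * K / b) * (a / b) ^+ q).
  clearbody a b; rewrite exprS expr_div_n; field.
  by rewrite expf_neq0 gt_eqF.
rewrite ler_wpM2l ?(ltW r0) // exprS ler_pM //.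
- by rewrite divr_ge0 // ?mulr_ge0 // ltW.
- by rewrite exprn_ge0 // divr_ge0 // ltW.
- by rewrite lerXn2r ?nnegrE // divr_ge0 // ltW.
Qed.

(** Square of [exp(-1/2) >= 1 - 1/2]. *)
Lemma expRN1_ge (F : realType) : 4^-1 <= expR (-1 : F).
Proof.
have h : 2^-1 <= expR (- 2^-1 : F).
  by apply: le_trans (expR_ge1Dx _); lra.
rewrite (_ : -1 = - 2^-1 + - 2^-1 :> F); last by lra.
rewrite exp.expRD; apply: le_trans (ler_pM _ _ h h); lra.
Qed.

(* [q.+1] is the integer part of [eps ^+ 4 * K / 192], at which the moment ratio
   is [4^-1] per step, and [4^-1 <= e^-1]. *)
Lemma exists_moment (F : realType) (r K eps delta : F) :
  1 <= r -> 0 < K -> 0 < eps < 1 -> 0 < delta < 5^-1 ->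
  576 * (r / (eps ^+ 4 * delta)) * ln (r / (eps ^+ 4 * delta)) <= r * K ->
  exists2 q : nat, q.+1%:R <= K &
    2 * (r * K) * (12 * q.+1%:R * K) ^+ q / (eps ^+ 2 * K / 2) ^+ q.+1.*2
      <= 2 * expR (- (10^-1 / delta)).
Proof.
move=> r1 K0 /andP[eps0 eps1] /andP[delta0 delta1]; set e := eps ^+ 4.
have e0 : 0 < e by rewrite exprn_gt0.
have e1 : e <= 1 by rewrite exprn_ile1 // ltW.
have r0 : 0 < r by apply: lt_le_trans r1.
set x := r / (e * delta); set L := ln x; pose z := delta^-1 => hd.
have z5 : 5 < z by rewrite -(invrK 5) ltf_pV2 ?posrE.
have xE : x = r * z / e by rewrite /x /z; field; rewrite !gt_eqF.
have rx : r <= x.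
  rewrite xE -mulrA ler_peMr ?(ltW r0) // ler_pdivlMr //; lra.
have zx : z <= x.
  rewrite xE ler_pdivlMr //; apply: (@le_trans _ _ z).
    by rewrite ler_piMr //; lra.
  by rewrite ler_peMl //; lra.
have x0 : 0 < x by lra.
(* From [x >= z > 5] and [exp 1 <= 4]. *)
have L1 : 1 <= L.
  rewrite -(expRK (1 : F)) ler_ln ?posrE ?expR_gt0 //.
  apply: le_trans zx; apply: (le_trans _ (ltW z5)).
  have := expRN1_ge F; rewrite expRN -[_^-1 in X in X <= _ -> _]div1r.
  rewrite -[(expR 1)^-1]div1r ler_pdivlMr ?expR_gt0 //; lra.
have rL : ln r <= L by rewrite ler_ln ?posrE.
pose y := e * K / 192.
(* Since [576 = 3 * 192], this is the lower bound on [d = r K] with [r] cancelled. *)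
have yL : 3 * z * L <= y.
  have : 576 * (r * z) * L / e <= r * K.
    by apply: le_trans hd; rewrite xE; lra.
  rewrite ler_pdivrMr // => h.
  rewrite /y ler_pdivlMr // -(ler_pM2l r0); lra.
have zL5 : 5 * L <= z * L by rewrite ler_wpM2r //; lra.
have zLz : z <= z * L by rewrite ler_peMr //; lra.
have y0 : 0 <= y by lra.
have /andP[py yp] := truncn_itv y0.
(* The integer part is not 0, because [y >= 3 z L >= 15]. *)
case: (Num.truncn y) py yp => [|q] py yp; first by lra.
have eK : 192 * q.+1%:R <= e * K by rewrite mulrC -ler_pdivlMr.
exists q.
  apply: (le_trans py); rewrite /y ler_pdivrMr //.
  by have := ler_wpM2r (ltW K0) e1; lra.
apply: le_trans (moment_ratio_le r0 K0 eps0 eK) _.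
apply: (@le_trans _ _ (expR (ln r) * expR (- 1) ^+ q.+1)).
  rewrite lnK ?posrE // ler_wpM2l ?(ltW r0) // lerXn2r ?nnegrE ?expR_ge0 //.
  exact: expRN1_ge.
rewrite -expRM_natr -exp.expRD.
apply: (@le_trans _ _ (expR (- (10^-1 / delta)))); last first.
  by have := expR_ge0 (- (10^-1 / delta)); lra.
(* The exponent [ln r - (q+1)] is below [L + 1 - 3 z L]; as [L + 1 <= 2 L <= (2/5) z L] and
   [z L >= z], it lies below [- z / 10]. *)
rewrite ler_expR -/z.
move: yp; rewrite -natr1; lra.
Qed.

Theorem theorem1p1 :
  exists (C c : R), 0 < C /\ 0 < c /\
  forall (m n : nat) (A : 'M[R]_(m, n)), A != 0 ->
  forall (eps delta : R), 0 < eps < 1 -> 0 < delta < 1 ->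
  forall d : nat, (d <= m)%N ->
  let r := frob A ^+ 2 / opnorm A ^+ 2 in
  C * (r / (eps ^+ 4 * delta)) * ln (r / (eps ^+ 4 * delta)) <= d%:R ->
  forall (VA : 'M[R]_n) (lamA : 'I_n -> R), eig_decomp (A^T *m A) VA lamA ->
  1 - 2 * expR (- (c / delta)) <=
  sample_prob A (fun J : {ffun 'I_d -> 'I_m} =>
    forall k : nat, (0 < k)%N ->
    forall (V : 'M[R]_n) (lam : 'I_n -> R),
      eig_decomp ((sampled A J)^T *m sampled A J) V lam ->
      opnorm (A - A *m proj_k V lam k) <= sing_val lamA k.+1 + eps * opnorm A).
Proof.
(* The value 576 is the one required by [exists_moment]. With [c = 1/10], any [delta >= 1/5] gives
   [c / delta <= 1/2], hence [2 exp(-c/delta) >= 1]. *)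
exists 576, 10^-1; split; first by rewrite ltr0n.
split; first by rewrite invr_gt0 ltr0n.
move=> m n A A0 eps delta heps /andP[delta0 delta1] d _ r hd VA lamA hA.
have [delta5|delta5] := ltP delta 5^-1; last first.
  (* the asserted lower bound is then nonpositive *)
  apply: (le_trans _ (sample_prob_ge0 _ _)); rewrite subr_le0.
  have h : 10^-1 / delta <= 2^-1 by rewrite ler_pdivrMr //; lra.
  by have := expR_ge1Dx (- (10^-1 / delta)); lra.
have f0 : 0 < frob A ^+ 2 by rewrite exprn_gt0 // frob_gt0.
have o0 : 0 < opnorm A ^+ 2 by rewrite exprn_gt0 // opnorm_gt0.
have r1 : 1 <= r.
  rewrite ler_pdivlMr // mul1r ler_pXn2r ?nnegrE ?opnorm_ge0 ?frob_ge0 //.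
  exact: opnorm_le_frob.
have [eps0 eps1] := andP heps.
have x1 : 1 < r / (eps ^+ 4 * delta).
  rewrite ltr_pdivlMr ?mulr_gt0 ?exprn_gt0 // mul1r.
  apply: lt_le_trans r1; rewrite -(mulr1 1) ltr_pM ?exprn_ge0 ?ltW //.
  by rewrite exprn_ilt1 // ltW.
pose K : R := d%:R * (opnorm A ^+ 2 / frob A ^+ 2).
have dE : d%:R = r * K.
  rewrite /r /K; field.
  by rewrite (gt_eqF (frob_gt0 A0)) (gt_eqF (opnorm_gt0 A0)).
(* The logarithm is positive because its argument exceeds 1, so the lower bound on [d] forces [d],
   and then [K], to be positive. *)
have d0 : 0 < d%:R :> R.
  apply: lt_le_trans hd; apply: mulr_gt0; last exact: ln_gt0.
  by apply: mulr_gt0; [rewrite ltr0n|exact: lt_trans ltr01 x1].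
have K0 : 0 < K by rewrite mulr_gt0 // divr_gt0.
rewrite dE in hd.
have delta_itv : 0 < delta < 5^-1 by rewrite delta0.
have [q qK tail] := exists_moment r1 K0 heps delta_itv hd.
apply: le_trans (sampled_approximation_prob A0 eps0 qK hA).
by rewrite lerD2l lerN2 -/K dE.
Qed.
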